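(* Let $\mathcal{P}$ be a fixed hyper-prior (chosen independently of the data) and let $\delta>0$. Then with probability at least $1-\delta$ over the sampling of the training datasets $S_1,\dots,S_n$, simultaneously for all hyper-posteriors $\mathcal{Q}$ and all posteriors $Q_1,\dots,Q_n$, $$\frac1n\sum_{i=1}^n \mathcal{R}_i(Q_i)\;\le\;\frac1n\sum_{i=1}^n \widehat{\mathcal{R}}_i(Q_i)+\sqrt{\frac{\mathrm{KL}(\mathfrak{Q}\|\mathfrak{P})+\log\frac{4m_{\mathrm h}n}{\delta}+1}{2m_{\mathrm h}n}},$$ where $m_{\mathrm h}=\dfrac{n}{\sum_{i=1}^n 1/m_i}$ is the harmonic mean of the training set sizes.
   Context: Multi-task setting: there are $n$ tasks; task $i$ has an unknown data distribution $D_i$ on a sample space $\mathcal{Z}$, a loss $\ell_i:\mathcal{F}\times\mathcal{Z}\to[0,1]$ on a hypothesis set $\mathcal{F}$, and a training set $S_i=(z_{i1},\dots,z_{im_i})$ of $m_i\ge1$ i.i.d. samples from $D_i$; the datasets $S_1,\dots,S_n$ are mutually independent. $\mathcal{M}(\mathcal{F})$ denotes the set of probability distributions on $\mathcal{F}$. For $Q\in\mathcal{M}(\mathcal{F})$, $\ell_i(Q,z)=\mathbb{E}_{f\sim Q}\ell_i(f,z)$, the true risk is $\mathcal{R}_i(Q)=\mathbb{E}_{z\sim D_i}\ell_i(Q,z)$ and the empirical risk is $\widehat{\mathcal{R}}_i(Q)=\frac1{m_i}\sum_{j=1}^{m_i}\ell_i(Q,z_{ij})$. A hyper-prior $\mathcal{P}$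 and a hyper-posterior $\mathcal{Q}$ are probability distributions on $\mathcal{M}(\mathcal{F})$ (the hyper-posterior and posteriors $Q_i\in\mathcal{M}(\mathcal{F})$ may depend on the data). $\mathfrak{Q}$ is the distribution on $\mathcal{M}(\mathcal{F})\times\mathcal{F}^n$ given by the product $\mathcal{Q}\times Q_1\times\cdots\times Q_n$; $\mathfrak{P}$ is the distribution on $\mathcal{M}(\mathcal{F})\times\mathcal{F}^n$ generated by sampling $P\sim\mathcal{P}$ and then $f_1,\dots,f_n$ i.i.d. from $P$. $\mathrm{KL}$ denotes the Kullback–Leibler divergence. *)

(* Defs.v *)
From HB Require Import structures.
From mathcomp Require Import all_boot all_order all_algebra.
From mathcomp Require Import all_classical all_reals all_analysis.

Set Implicit Arguments.
Unset Strict Implicit.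
Unset Printing Implicit Defensive.

Import Order.TTheory GRing.Theory Num.Theory.
Import numFieldNormedType.Exports.

Local Open Scope classical_set_scope.
Local Open Scope ring_scope.

Definition KL {d} {T : measurableType d} {R : realType}
    (mu nu : probability T R) : \bar R :=
  if pselect (mu `<< nu) then
    (\int[mu]_x (ln (fine (Radon_Nikodym (charge_of_finite_measure mu) nu x)))%:E)%E
  else (+oo)%E.

Section risks.
Context {dF dZ : measure_display} {F : measurableType dF}
  {Z : measurableType dZ} {R : realType}.

Definition loss_post (l : F -> Z -> R) (Q : probability F R) (z : Z) : R :=
  fine (\int[Q]_f (l f z)%:E)%E.

Definition true_risk (D : probability Z R) (l : F -> Z -> R)
    (Q : probability F R) : R :=
  fine (\int[D]_x (loss_post l Q x)%:E)%E.

Definition emp_risk (m : nat) (l : F -> Z -> R) (Q : probability F R)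
    (S : 'I_m -> Z) : R :=
  (m%:R)^-1 * \sum_(j < m) loss_post l Q (S j).
End risks.

Definition hmean_sizes {R : realType} (n : nat) (m : 'I_n -> nat) : R :=
  n%:R / \sum_(i < n) ((m i)%:R)^-1.

(** * Sampling of the training sets
    The samples z_{ij} (i < n, j < m_i) are random variables on a probability
    space (Omega, Pr), mutually independent, with z_{ij} distributed as D_i:
    the product rule holds for every family of measurable sets (taking
    A_{ij} = setT gives every subfamily). *)
Definition indep_samples {dO dZ : measure_display} {Omega : measurableType dO}
    {Z : measurableType dZ} {R : realType} (Pr : probability Omega R)
    (n : nat) (m : 'I_n -> nat) (D : 'I_n -> probability Z R)
    (z : forall i : 'I_n, 'I_(m i) -> Omega -> Z) : Prop :=
  (forall i j, measurable_fun setT (z i j)) /\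
  forall A : forall i : 'I_n, 'I_(m i) -> set Z,
    (forall i j, measurable (A i j)) ->
    Pr (\bigcap_(i in [set: 'I_n]) \bigcap_(j in [set: 'I_(m i)])
          (z i j @^-1` A i j))
    = (\prod_(i < n) \prod_(j < m i) D i (A i j))%E.

(** * The joint distributions on M(F) x F^n
    M(F) is the library's measurable space of probability measures
    [pprobability F R]; F^n is [n.-tuple F] with the product sigma-algebra.
    Both distributions are characterized by their values on the measurable
    rectangles A x B_1 x ... x B_n (a pi-system generating the product
    sigma-algebra), which determines them uniquely. *)
Definition rect {dF : measure_display} {F : measurableType dF} {R : realType}
    (n : nat) (A : set (pprobability F R)) (B : 'I_n -> set F)
    : set (pprobability F R * n.-tuple F)%type :=
  A `*` [set t : n.-tuple F | forall i, B i (tnth t i)].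

Definition is_joint_posterior {dF : measure_display} {F : measurableType dF}
    {R : realType} (n : nat) (hQ : probability (pprobability F R) R)
    (Q : 'I_n -> probability F R)
    (frakQ : probability (pprobability F R * n.-tuple F)%type R) : Prop :=
  forall (A : set (pprobability F R)) (B : 'I_n -> set F),
    measurable A -> (forall i, measurable (B i)) ->
    frakQ (rect A B) = (hQ A * \prod_(i < n) Q i (B i))%E.

(** frakP : sample P ~ hyperP, then f_1, ..., f_n i.i.d. from P *)
Definition is_joint_prior {dF : measure_display} {F : measurableType dF}
    {R : realType} (n : nat) (hP : probability (pprobability F R) R)
    (frakP : probability (pprobability F R * n.-tuple F)%type R) : Prop :=
  forall (A : set (pprobability F R)) (B : 'I_n -> set F),
    measurable A -> (forall i, measurable (B i)) ->
    frakP (rect A B) = (\int[hP]_(P in A) \prod_(i < n) P (B i))%E.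

(* Main.v *)
(** By Hoeffding's lemma and independence, the gap between true and empirical
    risk of a tuple of hypotheses is sub-Gaussian with variance proxy 1/(4N),
    where N = m_h n.  Tilting at 4Nx, for x on a grid of at most 4N points of
    [0, 1], and applying Markov's inequality to the sum of the exponential
    moments gives one event on which all of them are at most 4N/delta.  There the
    Donsker-Varadhan inequality bounds 4Nx a - 2Nx^2 by KL + ln (4N/delta) for
    each grid point x, a being the posterior mean of the gap; for x just below a
    this is at least 2Na^2 - 1, which is where the "+1" comes from.

    The joint prior is determined by the hyper-prior, so the event can be chosen
    before it is given. *)

Require Import Defs.
From HB Require Import structures.
From mathcomp Require Import all_boot all_order all_algebra.
From mathcomp Require Import all_classical all_reals all_analysis.
From mathcomp Require Import measurable_realfun ring lra.

Import Order.TTheory GRing.Theory Num.Theory.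
Import numFieldNormedType.Exports.

Local Open Scope classical_set_scope.
Local Open Scope ring_scope.

Set Implicit Arguments.
Unset Strict Implicit.
Unset Printing Implicit Defensive.


(** * Hoeffding's lemma *)

Lemma is_derive_ge0_le (R : realType) (f df : R -> R) (a b : R) :
  (forall x, a <= x -> is_derive x 1 f (df x)) ->
  (forall x, a <= x -> 0 <= df x) -> a <= b -> f a <= f b.
Proof.
move=> fE df0 ab.
apply: (@ger0_derive1_ndecr R f a b) => //.
- by move=> x /[!in_itv]/= /andP[ax _]; case: (fE x (ltW ax)).
- move=> x /[!in_itv]/= /andP[ax _].
  by rewrite derive1E; case: (fE x (ltW ax)) => _ ->; exact/df0/ltW.
- apply: derivable_within_continuous => x /[!in_itv]/= /andP[ax _].
  by case: (fE x ax).
Qed.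

(** The left side is the exponential moment at s of r - X for a Bernoulli variable X of mean r. The
    difference [h] of the logarithms vanishes at 0, as does its derivative [k], and k' >= 0, so two
    monotonicity arguments give h >= 0. *)
Lemma hoeffding_two_point (R : realType) (r s : R) : 0 <= r <= 1 -> 0 <= s ->
  (1 - r + r * expR (- s)) * expR (s * r) <= expR (s ^+ 2 / 8).
Proof.
move=> /andP[r0 r1] s0.
pose u : R -> R := fun x => 1 - r + r * expR (- x).
have u0 x : 0 < u x.
  have := expR_gt0 (- x); rewrite /u; case: (ltgtP r 0) r0 => // [r0|->] _ e0.
    by rewrite ltr_wpDl ?subr_ge0// mulr_gt0.
  by rewrite subr0 mul0r addr0.
have duE (x : R) : is_derive x 1 u (- (r * expR (- x))).
  by apply: is_derive_eq; rewrite /GRing.scale/=; ring.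
pose k : R -> R := fun x => x / 4 - r + r * expR (- x) / u x.
have k0 x : 0 <= x -> 0 <= k x.
  move=> x0.
  have <- : k 0 = 0.
    by rewrite /k /u oppr0 expR0 mulr1 subrK divr1 mul0r sub0r addNr.
  pose dk : R -> R := fun y => 4^-1 - (1 - r) * (r * expR (- y)) / u y ^+ 2.
  apply: (@is_derive_ge0_le R k dk 0 x _ _ x0) => y y0.
    have uy := lt0r_neq0 (u0 y).
    have ? := is_deriveV uy (duE y).
    apply: is_derive_eq; rewrite /GRing.scale/= /dk.
    move: uy; rewrite /u => uy; field.
    exact: uy.
  rewrite /dk subr_ge0 ler_pdivrMr ?exprn_gt0//.
  (* AM-GM: 4 (1 - r) b <= (1 - r + b)^2, so the subtracted quotient is at most 1/4. *)
  by rewrite /u; set b := r * _; have := sqr_ge0 (1 - r - b); nra.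
pose h : R -> R := fun x => x ^+ 2 / 8 - x * r - ln (u x).
have : h 0 <= h s.
  apply: (@is_derive_ge0_le R h k 0 s _ _ s0) => x x0; last exact: k0.
  have ? := @is_derive1_comp R _ _ x _ _ (is_derive1_ln (u0 x)) (duE x).
  apply: is_derive_eq; rewrite /GRing.scale/= /k; have := lt0r_neq0 (u0 x).
  by rewrite /u => ux; field.
rewrite /h /u oppr0 expR0 mulr1 subrK ln1 mul0r expr2 mulr0 mul0r !subr0.
rewrite -/(u s) subr_ge0 => hs.
rewrite -[X in X * _](@lnK _ (u s)) ?posrE// -expRD ler_expR.
by rewrite expr2; lra.
Qed.

Lemma integrable_bounded d (T : measurableType d) (R : realType)
    (mu : probability T R) (g : T -> R) (M : R) :
  measurable_fun setT g -> (forall x, `|g x| <= M) ->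
  mu.-integrable setT (EFin \o g).
Proof.
move=> mg gM.
apply: (@le_integrable _ _ _ mu _ measurableT _ (cst M%:E)) => //.
- exact/measurable_EFinP.
- by move=> x _ /=; rewrite lee_fin (le_trans (gM x))// ler_norm.
- exact: finite_measure_integrable_cst.
Qed.

Lemma integrable_itv01 d (T : measurableType d) (R : realType)
    (mu : probability T R) (g : T -> R) :
  measurable_fun setT g -> (forall x, 0 <= g x <= 1) ->
  mu.-integrable setT (EFin \o g).
Proof.
move=> mg g01; apply: (@integrable_bounded _ _ _ _ _ 1) => // x.
by have /andP[g0 g1] := g01 x; rewrite ger0_norm.
Qed.

(** Risks are defined as real numbers through [fine]; for [0, 1]-valued functions nothing is lost by
    it. *)
Lemma fine_integral_itv01 d (T : measurableType d) (R : realType)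
    (mu : probability T R) (g : T -> R) :
  measurable_fun setT g -> (forall x, 0 <= g x <= 1) ->
  (\int[mu]_x (g x)%:E = (fine (\int[mu]_x (g x)%:E))%:E)%E /\
  0 <= fine (\int[mu]_x (g x)%:E)%E <= 1.
Proof.
move=> mg g01.
have ig := integrable_itv01 mu mg g01.
have gE : (\int[mu]_y (g y)%:E = (fine (\int[mu]_x (g x)%:E))%:E)%E.
  by rewrite fineK//; exact: integrable_fin_num.
split => //; rewrite -!lee_fin -gE; apply/andP; split.
  by apply: integral_ge0 => x _; rewrite lee_fin; case/andP: (g01 x).
rewrite -[leRHS](@probability_setT _ _ _ mu) -[leRHS]mul1e -integral_cst//.
apply: ge0_le_integral => //.
- by move=> x _; rewrite lee_fin; case/andP: (g01 x).
- exact/measurable_EFinP.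
- by move=> x _; rewrite lee_fin; case/andP: (g01 x).
Qed.

(** Convexity of exp: the chord between 0 and - s lies above the graph. *)
Lemma expR_chord (R : realType) (s x : R) : 0 <= x <= 1 ->
  expR (- (s * x)) <= 1 - x + x * expR (- s).
Proof.
move=> /andP[x0 x1].
have := convex_expR (Itv01 x0 x1) (- s) 0.
by rewrite !convRE mulr0 addr0 expR0 mulr1 mulrN addrC (mulrC s).
Qed.

Lemma hoeffding d (T : measurableType d) (R : realType)
    (mu : probability T R) (g : T -> R) (s : R) :
  measurable_fun setT g -> (forall x, 0 <= g x <= 1) -> 0 <= s ->
  (\int[mu]_x (expR (s * (fine (\int[mu]_y (g y)%:E) - g x)))%:E
    <= (expR (s ^+ 2 / 8))%:E)%E.
Proof.
move=> mg g01 s0.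
have [rE r01] := fine_integral_itv01 mu mg g01.
have ig : mu.-integrable setT (EFin \o g) by exact: integrable_itv01.
set r := fine _ in rE r01 *.
have mE : measurable_fun setT (fun x => expR (s * (r - g x))).
  apply: measurableT_comp => //; apply: measurable_funM => //.
  exact: measurable_funB.
(* The chord bound is affine in [g x], so its integral depends on [g] only through the mean [r]:
   this reduces to the two-point case. *)
apply: (@le_trans _ _ (\int[mu]_x
   ((expR (s * r))%:E + ((expR (s * r) * (expR (- s) - 1)))%:E * (g x)%:E))%E).
  apply: ge0_le_integral => //.
  - exact/measurable_EFinP.
  - by apply: emeasurable_funD => //; apply: emeasurable_funM => //;
      exact/measurable_EFinP.
  - move=> x _; rewrite -EFinM -EFinD lee_fin mulrBr expRD.
    rewrite -[X in X + _]mulr1 -mulrA -mulrDr ler_wpM2l ?expR_ge0//.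
    by rewrite (le_trans (expR_chord s (g01 x)))//; lra.
rewrite integralD//; last 2 first.
- exact: finite_measure_integrable_cst.
- by apply: integrableZl.
rewrite integral_cst// [X in (_ * X + _)%E](_ : _ = 1%E) ?mule1;
  last exact: probability_setT.
rewrite integralZl// rE -EFinM -EFinD lee_fin.
by rewrite (le_trans _ (hoeffding_two_point r01 s0))//; lra.
Qed.

(** * Expectation of a product of independent variables *)

Section density.
Import HBNNSimple.

(** The image under [X] of the measure with density [h] agrees with c nu on measurable sets, hence
    on simple functions, hence on nonnegative measurable functions by monotone convergence. *)
Lemma ge0_integral_density_comp d d' (T : measurableType d)
    (U : measurableType d') (R : realType) (mu : {measure set T -> \bar R})
    (nu : {measure set U -> \bar R}) (X : T -> U) (h : T -> R) (c : R) :
  measurable_fun setT X -> measurable_fun setT h -> (forall x, 0 <= h x) ->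
  (forall A, measurable A ->
    \int[mu]_x (h x * \1_A (X x))%:E = c%:E * nu A)%E ->
  forall g : U -> \bar R, measurable_fun setT g -> (forall y, 0 <= g y)%E ->
  (\int[mu]_x ((h x)%:E * g (X x)) = c%:E * \int[nu]_y g y)%E.
Proof.
move=> mX mh h0 hA g mg g0.
pose G := nnsfun_approx measurableT mg.
have mG n : measurable_fun setT (G n) by exact/measurable_funP.
have cG y : EFin \o G ^~ y @ \oo --> g y by exact: cvg_nnsfun_approx.
have nG y a b : (a <= b)%N -> G a y <= G b y.
  by move=> ab; exact/lefP/nd_nnsfun_approx.
have GE n : (\int[mu]_x (h x * G n (X x))%:E = c%:E * \int[nu]_y (G n y)%:E)%E.
  have mI r : measurable (G n @^-1` [set r]) by [].
  have mF r : measurable_fun setT (fun x => h x * (r * \1_(G n @^-1` [set r]) (X x))).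
    apply: measurable_funM => //; apply: measurable_funM => //.
    exact: measurableT_comp.
  transitivity (\int[mu]_x (\sum_(r \in range (G n))
      (h x * (r * \1_(G n @^-1` [set r]) (X x)))%:E))%E.
    apply: eq_integral => x _; rewrite fsumEFin// {1}(fimfunE _ (X x)).
    rewrite !fsbig_finite//= mulr_sumr//.
  transitivity (c%:E * \int[nu]_y (\sum_(r \in range (G n))
      (r * \1_(G n @^-1` [set r]) y)%:E))%E; last first.
    congr (_ * _)%E; apply: eq_integral => y _.
    by rewrite fsumEFin// -fimfunE.
  have r0 r : r \in range (G n) -> 0 <= r.
    by rewrite inE => -[t _ <-].
  have ge0 r y : 0 <= r * \1_(G n @^-1` [set r]) y.
    by have := @nnfun_muleindic_ge0 _ _ _ (G n) r y; rewrite lee_fin.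
  rewrite !ge0_integral_fsum//.
  - rewrite ge0_mule_fsumr; last first.
      by move=> r; apply: integral_ge0 => y _; rewrite lee_fin.
    apply: eq_fsbigr => r rG.
    under eq_integral do rewrite mulrCA EFinM.
    rewrite ge0_integralZl//.
    + rewrite hA//.
      under [in RHS]eq_integral do rewrite EFinM.
      rewrite ge0_integralZl// ?integral_indic// ?setIT; last 2 first.
        exact/measurable_EFinP.
        by rewrite lee_fin r0.
      by rewrite muleCA.
    + apply/measurable_EFinP; apply: measurable_funM => //.
      exact: measurableT_comp.
    + by move=> x _; rewrite lee_fin mulr_ge0.
    + by rewrite lee_fin r0.
  - move=> r; apply/measurable_EFinP; exact: measurable_funM.
  - by move=> r y _; rewrite lee_fin.
  - by move=> r; exact/measurable_EFinP.
  - by move=> r x _; rewrite lee_fin mulr_ge0.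
have L : (\int[mu]_x (h x * G n (X x))%:E)%E @[n --> \oo] -->
    (\int[mu]_x ((h x)%:E * g (X x)))%E.
  have -> : (\int[mu]_x ((h x)%:E * g (X x)) =
      \int[mu]_x limn (fun n => (h x * G n (X x))%:E))%E.
    apply: eq_integral => x _; apply/esym/cvg_lim => //.
    by under eq_fun do rewrite EFinM; apply: cvgeZl => //; exact: cG.
  apply: cvg_monotone_convergence => //.
  - move=> n; apply/measurable_EFinP; apply: measurable_funM => //.
    exact: measurableT_comp.
  - by move=> n x _; rewrite lee_fin mulr_ge0.
  - by move=> x _ a b ab; rewrite lee_fin ler_wpM2l// nG.
have M : (c%:E * \int[nu]_y (G n y)%:E)%E @[n --> \oo] --> (c%:E * \int[nu]_y g y)%E.
  apply: cvgeZl => //.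
  suff -> : (\int[nu]_y g y)%E =
      (\int[nu]_y limn (fun n => (G n y)%:E))%E.
    apply: cvg_monotone_convergence => //.
    - by move=> n; exact/measurable_EFinP.
    - by move=> n x _; rewrite lee_fin.
    - by move=> x _ a b ab; rewrite lee_fin nG.
  by apply: eq_integral => y _; apply/esym/cvg_lim => //; exact: cG.
rewrite -(cvg_lim _ L)//; under eq_fun do rewrite GE.
exact: cvg_lim M.
Qed.

End density.

Lemma indep_integral_prod d d' (T : measurableType d) (U : measurableType d')
    (R : realType) (P : probability T R) (I : finType)
    (mu : I -> probability U R) (X : I -> T -> U) :
  (forall i, measurable_fun setT (X i)) ->
  (forall A : I -> set U, (forall i, measurable (A i)) ->
    P (\bigcap_(i in [set: I]) (X i @^-1` A i)) = \prod_i mu i (A i))%E ->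
  forall g : I -> U -> R, (forall i, measurable_fun setT (g i)) ->
  (forall i y, 0 <= g i y) ->
  (forall i, \int[mu i]_y (g i y)%:E < +oo)%E ->
  (\int[P]_x (\prod_i g i (X i x))%:E = \prod_i \int[mu i]_y (g i y)%:E)%E.
Proof.
move=> mX PX g mg g0 goo.
(* Induction on a list [s] of the indices whose factor need not be an indicator. *)
suff : forall s : seq I, (forall i, i \notin s ->
    exists2 A, measurable A & g i = \1_A) ->
    (\int[P]_x (\prod_i g i (X i x))%:E = \prod_i \int[mu i]_y (g i y)%:E)%E.
  by move=> /(_ (fintype.enum I)); apply => i; rewrite mem_enum.
move=> s; elim: s g mg g0 goo => [|i s IH] g mg g0 goo gs.
  have /choice[A gA] i : exists A, measurable A /\ g i = \1_A.
    by have [A mA gA] := gs i isT; exists A.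
  have mA i : measurable (A i) by case: (gA i).
  under [RHS]eq_bigr => i _.
    rewrite (gA i).2 integral_indic// setIT; over.
  rewrite -PX// -[in RHS](setIT (\bigcap_(_ in _) _)) -integral_indic//; last first.
    apply: fin_bigcap_measurable => // i _.
    by rewrite -[X in measurable X]setTI; exact: mX.
  apply: eq_integral => x _; congr EFin.
  rewrite indicE; case: (boolP (x \in _)) => [/set_mem xA|].
    rewrite big1 // => i _; rewrite (gA i).2 indicE mem_set//; exact: xA.
  rewrite notin_setE => xA.
  have [i Ai] : exists i, ~ A i (X i x).
    by apply/existsNP => xA'; apply: xA => i _; exact: xA'.
  apply/eqP; rewrite prodf_seq_eq0; apply/hasP; exists i; first exact: mem_index_enum.
  by rewrite (gA i).2 indicE memNset ?eqxx.
have [si|si] := boolP (i \in s).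
  apply: IH => // j js; apply: gs; rewrite inE negb_or js andbT.
  by apply: contraNneq js => ->.
(* The product of the other factors serves as density for the variable [X i]. Its constant [c] is
   finite because every factor has a finite integral. *)
pose h x := \prod_(j | j != i) g j (X j x).
have I0 j : (0 <= \int[mu j]_y (g j y)%:E)%E.
  by apply: integral_ge0 => y _; rewrite lee_fin.
have If j : (\int[mu j]_y (g j y)%:E)%E \is a fin_num.
  by rewrite ge0_fin_numE.
pose c := (\prod_(j | j != i) \int[mu j]_y (g j y)%:E)%E.
have cfin : c \is a fin_num by apply: prode_fin_num.
rewrite (bigD1 i)//= -/c muleC -(fineK cfin).
rewrite -(@ge0_integral_density_comp _ _ T U R P (mu i) (X i) h (fine c))//.
- apply: eq_integral => x _; rewrite -EFinM; congr EFin.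
  by rewrite (bigD1 i)//= mulrC.
- have -> : h = fun x => \prod_(j <- [seq j <- index_enum I | j != i]) g j (X j x).
    by apply/funext => x; rewrite big_filter.
  by apply: measurable_prod => j _; exact: measurableT_comp.
- by move=> x; apply: prodr_ge0 => j _.
(* With an indicator put at [i], the family falls under the induction hypothesis, which gives the
   density identity on sets. *)
- move=> A mA; pose g' j := if j == i then \1_A else g j.
  have g'i : g' i = \1_A by rewrite /g' eqxx.
  have g'j j : j != i -> g' j = g j by rewrite /g' => /negbTE ->.
  transitivity (\int[P]_x (\prod_j g' j (X j x))%:E)%E.
    apply: eq_integral => x _; congr EFin.
    rewrite [RHS](bigD1 i)//= g'i mulrC; congr (_ * _).
    by apply: eq_bigr => j /g'j ->.
  rewrite IH//.
  - rewrite (bigD1 i)//= g'i integral_indic// setIT fineK// muleC; congr (_ * _)%E.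
    by apply: eq_bigr => j /g'j ->.
  - by move=> j; rewrite /g'; case: ifP.
  - by move=> j y; rewrite /g'; case: ifP.
  - move=> j; rewrite /g'; case: ifPn => // _.
    by rewrite integral_indic// setIT (le_lt_trans (probability_le1 _ _))// ltry.
  - move=> j js; have [->|ji] := eqVneq j i; first by exists A.
    by rewrite g'j//; apply: gs; rewrite inE negb_or ji.
- exact/measurable_EFinP.
- by move=> y; rewrite lee_fin.
Qed.

(** * Donsker-Varadhan inequality *)

(** Positive and negative parts are compared separately, so that the lemma applies to a log-density
    whose integral is not yet known to be finite. *)
Lemma ae_le_integral d (T : measurableType d) (R : realType)
    (mu : {measure set T -> \bar R}) (f g : T -> \bar R) :
  measurable_fun setT f -> measurable_fun setT g ->
  {ae mu, forall x, f x <= g x}%E -> (\int[mu]_x f x <= \int[mu]_x g x)%E.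
Proof.
move=> mf mg fg; rewrite (integralE _ _ f) (integralE _ _ g) leeB//;
  apply: ae_ge0_le_integral => //.
- exact: measurable_funepos.
- exact: measurable_funepos.
- by apply: filterS fg => x fg _; rewrite !funeposE ge_max !le_max fg lexx orbT.
- exact: measurable_funeneg.
- exact: measurable_funeneg.
- by apply: filterS fg => x fg _; rewrite !funenegE ge_max !le_max leeN2 fg lexx orbT.
Qed.

(** With f the density of [mu] and phi = exp(g) / f, the inequality 1 + t <= exp(t) at t = g - ln f
    - ln C gives ln f >= g - ln C + 1 - phi / C. Integrating against [mu] suffices, since phi has
    [mu]-integral at most C. *)
Lemma donsker_varadhan d (T : measurableType d) (R : realType)
    (mu nu : probability T R) (g : T -> R) (C : R) :
  0 < C -> mu.-integrable setT (EFin \o g) ->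
  (\int[nu]_x (expR (g x))%:E <= C%:E)%E -> (KL mu nu < +oo)%E ->
  KL mu nu \is a fin_num /\ (\int[mu]_x (g x)%:E <= KL mu nu + (ln C)%:E)%E.
Proof.
move=> C0 ig gC; rewrite /KL; case: pselect => // numu KLoo.
set rn := Radon_Nikodym _ _ in KLoo *.
pose f := fine \o rn.
have mg : measurable_fun setT g by apply/measurable_EFinP; exact: measurable_int ig.
have mrn : measurable_fun setT rn.
  by apply: (measurable_int nu); exact: Radon_Nikodym_integrable.
have mf : measurable_fun setT f by apply: measurableT_comp => //; exact: fine_measurable.
have fE x : rn x = (f x)%:E by rewrite fineK//; exact: Radon_Nikodym_fin_num.
have mf0 : measurable_fun setT (fun x => 0 < f x) by exact: measurable_fun_ltr.
(* The [mu]-mass of the set where f <= 0 is the [nu]-integral of f over it, hence at most 0. *)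
have f_gt0 : {ae mu, forall x, 0 < f x}.
  exists [set x | ~~ (0 < f x)]; split.
  - have := mf0 measurableT [set false] I; rewrite setTI.
    by congr (measurable _); apply/seteqP; split => x /=; case: (0 < f x).
  - apply/eqP; rewrite eq_le measure_ge0 andbT.
    have mN : measurable [set x | ~~ (0 < f x)].
      have := mf0 measurableT [set false] I; rewrite setTI.
      by congr (measurable _); apply/seteqP; split => x /=; case: (0 < f x).
    rewrite -[mu _]/(charge_of_finite_measure mu _).
    rewrite (@Radon_Nikodym_integral _ _ _ (charge_of_finite_measure mu) nu)//.
    have N0 x : [set x | ~~ (0 < f x)] x -> (0 <= - rn x)%E.
      by move=> /= xN; rewrite fE -EFinN lee_fin oppr_ge0 leNgt.
    under eq_integral do rewrite -/rn -[rn _]oppeK.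
    by rewrite integral_ge0N// oppe_le0 integral_ge0.
  - by move=> x /= /negP.
pose phi x : R := if 0 < f x then expR (g x - ln (f x)) else 0.
have phi0 x : 0 <= phi x by rewrite /phi; case: ifP => // _; exact: expR_ge0.
have mphi : measurable_fun setT phi.
  apply: measurable_fun_ifT => //; apply: measurableT_comp => //.
  by apply: measurable_funB => //; exact: measurableT_comp.
(* Changing measure turns this into the [nu]-integral of phi f, which is exp(g) where f > 0 and 0
   elsewhere. The two versions of the density agree [nu]-almost everywhere. *)
have phiC : (\int[mu]_x (phi x)%:E <= C%:E)%E.
  rewrite -(Radon_Nikodym_SigmaFinite.change_of_variables numu)//;
    last exact/measurable_EFinP.
  apply: le_trans gC; apply: ae_ge0_le_integral => //.
  - move=> x _; rewrite mule_ge0 ?lee_fin//.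
    exact: Radon_Nikodym_SigmaFinite.f_ge0.
  - apply: emeasurable_funM; first exact/measurable_EFinP.
    apply: (measurable_int nu); exact: Radon_Nikodym_SigmaFinite.f_integrable.
  - by apply/measurable_EFinP; exact: measurableT_comp.
  - apply: filterS (ae_eq_Radon_Nikodym_SigmaFinite numu measurableT) => x /= fx _.
    rewrite fx// -/rn fE -EFinM lee_fin /phi; case: ifPn => [f0|_]; last first.
      by rewrite mul0r expR_ge0.
    by rewrite expRB lnK ?posrE// divfK ?gt_eqF.
have iphi : mu.-integrable setT (EFin \o phi).
  apply/integrableP; split; first exact/measurable_EFinP.
  under eq_integral do rewrite /= ger0_norm//.
  exact: le_lt_trans phiC (ltry _).
pose l x := g x - ln C - C^-1 * phi x + 1.
have il : (\int[mu]_x (l x)%:E =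
    \int[mu]_x (g x)%:E - (ln C)%:E - C^-1%:E * \int[mu]_x (phi x)%:E + 1)%E.
  rewrite /l; under eq_integral do rewrite EFinD EFinB EFinB EFinM.
  have ic c : mu.-integrable setT (cst c%:E) by exact: finite_measure_integrable_cst.
  have ip : mu.-integrable setT (fun x => C^-1%:E * (phi x)%:E)%E by exact: integrableZl.
  have i1 : mu.-integrable setT (fun x => (g x)%:E - (ln C)%:E)%E.
    by apply: integrableB => //; exact: ic.
  have i2 : mu.-integrable setT (fun x => (g x)%:E - (ln C)%:E - C^-1%:E * (phi x)%:E)%E.
    exact: integrableB.
  rewrite (integralD measurableT i2 (ic 1)) (integralB measurableT i1 ip).
  rewrite (integralB measurableT ig (ic (ln C))) integralZl//.
  have muT (c : \bar R) : (c * mu setT = c)%E by rewrite probability_setT mule1.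
  by rewrite !integral_cst// !muT.
have lL : {ae mu, forall x, ((l x)%:E <= (ln (f x))%:E)%E}.
  apply: filterS f_gt0 => x f0; rewrite lee_fin /l /phi f0.
  have := expR_ge1Dx (g x - ln (f x) - ln C).
  rewrite expRB (lnK) ?posrE// mulrC; lra.
have ml : measurable_fun setT (EFin \o l).
  apply/measurable_EFinP; rewrite /l; apply: measurable_funD => //.
  by apply: measurable_funB; [exact: measurable_funB|exact: measurable_funM].
have mL : measurable_fun setT (fun x => (ln (f x))%:E).
  by apply/measurable_EFinP; exact: measurableT_comp.
have := ae_le_integral ml mL lL; rewrite /= il -/rn.
have gfin := integrable_fin_num measurableT ig.
have pfin := integrable_fin_num measurableT iphi.
rewrite /= in gfin pfin.
(* The hypothesis excludes the value +oo, and the finite lower bound excludes -oo. *)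
move: KLoo phiC; rewrite -/rn -(fineK gfin) -(fineK pfin).
set K := (\int[mu]_x _)%E; case: K => [k|//|_ _].
  move=> _ pC glk; split => //.
  rewrite lee_fin in pC.
  have : C^-1 * fine (\int[mu]_x (phi x)%:E) <= 1 by rewrite ler_pdivrMl ?mulr1.
  by move: glk; rewrite !lee_fin; lra.
by rewrite -EFinM -!EFinB -EFinD leeNy_eq.
Qed.

(** * Joint priors and posteriors *)

Lemma measurable_rect d (F : measurableType d) (R : realType) n
    (A : set (pprobability F R)) (B : 'I_n -> set F) :
  measurable A -> (forall i, measurable (B i)) -> measurable (rect A B).
Proof.
move=> mA mB; apply: measurableX => //.
rewrite [X in measurable X](_ : _ =
    \bigcap_(i in [set: 'I_n]) ((@tnth n F ^~ i) @^-1` B i)); last first.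
  by apply/seteqP; split => t /= tB i => [_|]; apply: tB.
apply: fin_bigcap_measurable => // i _.
by rewrite -[X in measurable X]setTI; exact: measurable_tnth.
Qed.

(** The preimage of a measurable set under a coordinate is a rectangle with all other sides full, so
    the identity out of the generated sigma-algebra is measurable coordinate by coordinate. *)
Lemma measurable_rectE d (F : measurableType d) (R : realType) n :
  @measurable _ (pprobability F R * n.-tuple F)%type =
  <<s [set X | exists A B, [/\ measurable A,
        forall i, measurable (B i) & X = @rect d F R n A B] ]>>.
Proof.
set G := [set X | _]; apply/seteqP; split; last first.
  apply: smallest_sub; first exact: sigma_algebra_measurable.
  by move=> _ [A [B [mA mB ->]]]; exact: measurable_rect.
pose T' := g_sigma_algebraType G.
have mG A B : measurable A -> (forall i, measurable (B i)) -> <<s G >> (rect A B).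
  by move=> mA mB; apply: sub_sigma_algebra; exists A, B.
suff mid : measurable_fun setT (id : T' -> (pprobability F R * n.-tuple F)%type).
  by move=> X /(mid measurableT); rewrite setTI.
apply/measurable_fun_pairP; split.
- move=> _ A mA; rewrite setTI.
  rewrite [X in measurable X](_ : _ = rect A (fun=> setT)); first exact: mG.
  by apply/seteqP; split => x /=; [split|case].
- apply/measurable_fun_tnthP => i _ C mC; rewrite setTI.
  rewrite [X in measurable X](_ : _ = rect setT (fun j => if j == i then C else setT)).
    by apply: mG => // j; case: ifP.
  apply/seteqP; split => x /=; last by case=> _ /(_ i); rewrite eqxx.
  by move=> Cx; split => // j /=; case: eqP => [->|].
Qed.

(** Rectangles form a generating pi-system that contains the whole space. *)
Lemma joint_prior_unique d (F : measurableType d) (R : realType) n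
    (hP : probability (pprobability F R) R)
    (P P' : probability (pprobability F R * n.-tuple F)%type R) :
  is_joint_prior hP P -> is_joint_prior hP P' ->
  forall X, measurable X -> P X = P' X.
Proof.
move=> hPP hPP'.
apply: (measure_unique _ (fun=> setT) (measurable_rectE F R n)).
- move=> _ _ [A [B [mA mB ->]]] [A' [B' [mA' mB' ->]]].
  exists (A `&` A'), (fun i => B i `&` B' i); split.
  + exact: measurableI.
  + by move=> i; exact: measurableI.
  + apply/seteqP; split => x /=.
      by move=> [[? h] [? h']]; split=> [//|i]; split; [exact: h|exact: h'].
    by move=> [[? ?] h]; split; split=> [//|i]; case: (h i).
- move=> _; exists setT, (fun=> setT); split => //.
  by apply/seteqP; split.
- by rewrite bigcup_const.
- by move=> _ [A [B [mA mB ->]]]; exact: etrans (hPP _ _ mA mB) (esym (hPP' _ _ mA mB)).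
- by move=> _; rewrite fin_num_fun_lty ?fin_num_measure.
Qed.

(** * Risks as averages over single hypotheses *)

Section risks.
Context (R : realType) (dZ dF : measure_display) (Z : measurableType dZ)
  (F : measurableType dF) (l : F -> Z -> R).
Hypothesis l01 : forall f x, 0 <= l f x <= 1.
Hypothesis ml : measurable_fun [set: F * Z] (fun p => l p.1 p.2).

Let ml1 f : measurable_fun setT (l f).
Proof. exact: measurableT_comp ml (pair1_measurable f). Qed.

Let ml2 x : measurable_fun setT (l ^~ x).
Proof. exact: measurableT_comp ml (pair2_measurable x). Qed.

Lemma measurable_hypothesis_risk (D : probability Z R) :
  measurable_fun setT (fun f => fine (\int[D]_x (l f x)%:E)%E).
Proof.
apply: (@measurableT_comp _ _ _ _ _ _ fine); first exact: fine_measurable.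
apply: (@measurable_fun_fubini_tonelli_F _ _ F Z R D (fun p => (l p.1 p.2)%:E)).
  exact/measurable_EFinP.
by move=> p; rewrite lee_fin; case/andP: (l01 p.1 p.2).
Qed.

(** Tonelli's theorem: [true_risk] averages over hypotheses first, the left side over samples
    first. *)
Lemma integral_hypothesis_risk (D : probability Z R) (Q : probability F R) :
  (\int[Q]_f (fine (\int[D]_x (l f x)%:E))%:E = (true_risk D l Q)%:E)%E.
Proof.
have l0 p : (0 <= (l p.1 p.2)%:E)%E by rewrite lee_fin; case/andP: (l01 p.1 p.2).
have mlE : measurable_fun setT (fun p : F * Z => (l p.1 p.2)%:E).
  exact/measurable_EFinP.
under eq_integral => f _ do rewrite -(fine_integral_itv01 D (ml1 f) (l01 f)).1.
rewrite (fubini_tonelli (m1 := Q) (m2 := D) (fun p => (l p.1 p.2)%:E) mlE l0)/=.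
have mlp : measurable_fun setT (fun x => loss_post l Q x).
  apply: (@measurableT_comp _ _ _ _ _ _ fine); first exact: fine_measurable.
  exact: (@measurable_fun_fubini_tonelli_G _ _ F Z R Q (fun p => (l p.1 p.2)%:E)).
have lpE x := fine_integral_itv01 Q (ml2 x) (l01 ^~ x).
rewrite /true_risk -(fine_integral_itv01 D mlp (fun x => (lpE x).2)).1.
by apply: eq_integral => x _; rewrite (lpE x).1.
Qed.

Lemma integral_hypothesis_emp_risk m (S : 'I_m -> Z) (Q : probability F R) :
  (\int[Q]_f (m%:R^-1 * \sum_(j < m) l f (S j))%:E = (emp_risk l Q S)%:E)%E.
Proof.
have ilj j : Q.-integrable setT (fun f => (l f (S j))%:E).
  exact: integrable_itv01 (ml2 (S j)) (l01 ^~ _).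
under eq_integral do rewrite EFinM -sumEFin.
rewrite integralZl//; last exact: integrable_sum.
rewrite integral_sum// /emp_risk EFinM -sumEFin; congr (_ * _)%E.
by apply: eq_bigr => j _; rewrite (fine_integral_itv01 Q (ml2 (S j)) (l01 ^~ _)).1.
Qed.

End risks.

(** The marginal of [QQ] at coordinate [i] is [Q i], as seen on rectangles with every other side
    full. *)
Lemma integral_joint_posterior_tnth d (F : measurableType d) (R : realType) n
    (hQ : probability (pprobability F R) R) (Q : 'I_n -> probability F R)
    (QQ : probability (pprobability F R * n.-tuple F)%type R)
    (i : 'I_n) (phi : F -> R) (M : R) :
  is_joint_posterior hQ Q QQ ->
  measurable_fun setT phi -> (forall f, `|phi f| <= M) ->
  (\int[QQ]_x (phi (tnth x.2 i))%:E = \int[Q i]_f (phi f)%:E)%E.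
Proof.
move=> QQE mphi phiM.
pose X (x : pprobability F R * n.-tuple F) := tnth x.2 i.
have mX : measurable_fun setT X.
  exact: measurableT_comp (measurable_tnth i) measurable_snd.
have := @integral_pushforward _ _ _ _ _ X mX QQ setT (EFin \o phi).
rewrite preimage_setT => <-//; last 2 first.
- exact/measurable_EFinP.
- apply: (@integrable_bounded _ _ _ _ (phi \o X) M) => //.
    exact: measurableT_comp.
  by move=> x; exact: phiM.
apply: eq_measure_integral => A mA _ /=.
have := QQE setT (fun j => if j == i then A else setT) measurableT.
rewrite probability_setT mul1e (bigD1 i)//= eqxx big1 ?mule1; last first.
  by move=> j /negbTE ->; rewrite probability_setT.
move=> <-; last by move=> j; case: ifP.
rewrite /pushforward; congr (QQ _); apply/seteqP; split => x /=.
  by move=> Ax; split => // j /=; case: eqP => [->|].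
by case=> _ /(_ i); rewrite eqxx.
Qed.

(** * The grid of tilting parameters *)

(** The number of mesh intervals of [0, 1]. Exceeding 2N makes the mesh finer than 1 / (2N), while
    for N >= 1 the number of grid points, one more, stays at most 2N + 2 <= 4N. *)
Definition grid_size (R : realType) (N : R) : nat := (Num.truncn (2 * N)).+1.

Lemma grid_size_le (R : realType) (N : R) : 1 <= N ->
  (grid_size N).+1%:R <= 4 * N.
Proof.
move=> N1; have N0 : 0 <= 2 * N by lra.
have := truncn_itv N0; move=> /andP[+ _].
rewrite /grid_size -addn2 natrD; lra.
Qed.

Definition grid_pt (R : realType) (N : R) (k : nat) : R := k%:R / (grid_size N)%:R.

(** Completing the square, 4Nxa - 2Nx^2 = 2Na^2 - 2N(a - x)^2, so a grid point x with 2N(a - x)^2 <=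
    1 yields 2Na^2 <= B + 1. *)
Lemma grid_sqrt (R : realType) (N a B : R) : 1 <= N -> a <= 1 ->
  (forall k : 'I_(grid_size N).+1,
    4 * N * grid_pt N k * a - 2 * N * grid_pt N k ^+ 2 <= B) ->
  a <= Num.sqrt ((B + 1) / (2 * N)).
Proof.
move=> N1 a1 aB; have [a0|a0] := leP a 0; first by rewrite (le_trans a0) ?sqrtr_ge0.
set M := (grid_size N)%:R : R.
have M2 : 2 * N <= M by rewrite /M ltW// truncnS_gt.
have M0 : 0 < M by lra.
have aM0 : 0 <= a * M by rewrite mulr_ge0 ?ltW.
(* Round [a] down to the grid; a <= 1 keeps the index in range. *)
have := truncn_itv aM0; move=> /andP[k1 k2].
have kM : (Num.truncn (a * M) < (grid_size N).+1)%N.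
  rewrite ltnS -(ler_nat R) (le_trans k1)// -/M; nra.
have := aB (Ordinal kM); rewrite /= /grid_pt -/M.
set x := _ / M.
have xa : x <= a by rewrite ler_pdivrMr.
have ax : (a - x) * M <= 1.
  by rewrite mulrBl divfK ?gt_eqF// lerBlDr addrC natr1 ltW.
(* Bound 2N by M, then use M(a - x) <= 1 and a - x <= 1. *)
have aux : 2 * N * (a - x) ^+ 2 <= 1.
  have u0 : 0 <= a - x by rewrite subr_ge0.
  have u1 : a - x <= 1 by rewrite (le_trans _ ax)// ler_peMr//; lra.
  apply: (@le_trans _ _ ((a - x) * M * (a - x))).
    by rewrite expr2 mulrA ler_wpM2r// mulrC ler_wpM2l.
  by rewrite mulr_ile1// mulr_ge0// ltW.
move=> xB.
have aE : a = Num.sqrt (a ^+ 2) by rewrite sqrtr_sqr ger0_norm// ltW.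
rewrite {1}aE; apply: ler_wsqrtr; rewrite ler_pdivlMr; last lra.
by move: xB aux; rewrite !expr2; lra.
Qed.

(** * The risk gap *)

Lemma prode_le (R : realDomainType) (I : Type) (r : seq I) (f g : I -> \bar R) :
  (forall i, 0 <= f i <= g i)%E ->
  (\prod_(i <- r) f i <= \prod_(i <- r) g i)%E.
Proof.
move=> fg; suff /andP[] : (0 <= \prod_(i <- r) f i <= \prod_(i <- r) g i)%E by [].
elim/big_rec2 : _ => [|i y x _ /andP[x0 xy]]; first by rewrite lee01 lexx.
by have /andP[f0 ?] := fg i; rewrite mule_ge0//= lee_pmul.
Qed.

Definition gap (R : realType) (dZ dF : measure_display) (Z : measurableType dZ)
    (F : measurableType dF) n (m : 'I_n -> nat) (D : 'I_n -> probability Z R)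
    (loss : 'I_n -> F -> Z -> R) (S : forall i, 'I_(m i) -> Z) (h : 'I_n -> F) : R :=
  n%:R^-1 * \sum_(i < n) (fine (\int[D i]_x (loss i (h i) x)%:E)%E
    - (m i)%:R^-1 * \sum_(j < m i) loss i (h i) (S i j)).

Section pac_bayes.
Context (R : realType) (dO dZ dF : measure_display)
  (Omega : measurableType dO) (Z : measurableType dZ) (F : measurableType dF)
  (Pr : probability Omega R) (n : nat) (m : 'I_n -> nat)
  (D : 'I_n -> probability Z R) (loss : 'I_n -> F -> Z -> R)
  (z : forall i : 'I_n, 'I_(m i) -> Omega -> Z).
Hypotheses (n0 : (0 < n)%N) (m0 : forall i, (0 < m i)%N).
Hypothesis loss01 : forall i f x, 0 <= loss i f x <= 1.
Hypothesis mloss :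
  forall i, measurable_fun [set: F * Z] (fun p => loss i p.1 p.2).
Hypothesis zD : indep_samples Pr D z.

Local Notation MF := (pprobability F R * n.-tuple F)%type.
Local Notation N := (hmean_sizes m * n%:R : R).

Lemma sum_inv_sizes_gt0 : 0 < \sum_(i < n) ((m i)%:R)^-1 :> R.
Proof.
rewrite (bigD1 (Ordinal n0))//= ltr_pwDl ?invr_gt0 ?ltr0n//.
by apply: sumr_ge0 => i _; rewrite invr_ge0.
Qed.

(** Flattens the double index into one finite type of pairs, the form that [indep_integral_prod]
    takes. *)
Lemma indep_samples_sig (A : {i : 'I_n & 'I_(m i)} -> set Z) :
  (forall p, measurable (A p)) ->
  (Pr (\bigcap_(p in [set: {i : 'I_n & 'I_(m i)}]) (z (tagged p) @^-1` A p))
    = \prod_p D (tag p) (A p))%E.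
Proof.
move=> mA; have := zD.2 (fun i j => A (Tagged _ j)) (fun i j => mA _).
rewrite (sig_big_dep (fun=> true) (fun _ _ => true)
  (fun i (j : 'I_(m i)) => D i (A (Tagged (fun i => 'I_(m i)) j)))) /= => PrE.
transitivity (Pr (\bigcap_(i in [set: 'I_n]) \bigcap_(j in [set: 'I_(m i)])
    (z j @^-1` A (Tagged (fun i => 'I_(m i)) j)))).
  congr (Pr _); apply/seteqP; split => w /= wA.
    by move=> i _ j _; exact: (wA (Tagged _ j)).
  by case=> i j _; exact: wA.
by rewrite PrE; apply: eq_bigr => -[].
Qed.

(** The exponent is a sum over all samples with weights c_i = s / (n m_i). Hoeffding's lemma gives
    each sample the factor exp(c_i^2 / 8), and the sum of m_i c_i^2 is (s / n)^2 times the sum of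
    the 1 / m_i, that is s^2 / N. *)
Lemma gap_mgf (h : 'I_n -> F) (s : R) : 0 <= s ->
  (\int[Pr]_w (expR (s * gap D loss (fun i j => @z i j w) h))%:E
    <= (expR (s ^+ 2 / (8 * (hmean_sizes m * n%:R))))%:E)%E.
Proof.
move=> s0.
have nR : n%:R != 0 :> R by rewrite pnatr_eq0 -lt0n.
have mR i : (m i)%:R != 0 :> R by rewrite pnatr_eq0 -lt0n.
pose c i : R := s / n%:R / (m i)%:R.
pose r i : R := fine (\int[D i]_x (loss i (h i) x)%:E)%E.
pose g (p : {i : 'I_n & 'I_(m i)}) y :=
  expR (c (tag p) * (r (tag p) - loss (tag p) (h (tag p)) y)).
have c0 i : 0 <= c i by rewrite !divr_ge0.
have ml i : measurable_fun setT (loss i (h i)).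
  exact: (measurableT_comp (mloss i) (pair1_measurable (h i))).
have gE w : expR (s * gap D loss (fun i j => @z i j w) h) = \prod_p g p (z (tagged p) w).
  rewrite -expR_sum; congr expR.
  rewrite -(@sig_big_dep _ _ _ _ _ (fun=> true) (fun _ _ => true)
    (fun i j => c i * (r i - loss i (h i) (z j w)))) /=.
  rewrite /gap mulrA mulr_sumr; apply: eq_bigr => i _.
  rewrite -mulr_sumr sumrB sumr_const card_ord -/(r i) /c -mulr_natl.
  by field; rewrite nR mR.
under eq_integral do rewrite gE.
have gH p : (\int[D (tag p)]_y (g p y)%:E <= (expR (c (tag p) ^+ 2 / 8))%:E)%E.
  exact: hoeffding.
rewrite (indep_integral_prod _ indep_samples_sig)//.
- apply: (@le_trans _ _
    (\prod_(p : {i : 'I_n & 'I_(m i)}) (expR (c (tag p) ^+ 2 / 8))%:E)%E).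
    apply: prode_le => p; rewrite gH andbT integral_ge0// => y _.
    by rewrite lee_fin expR_ge0.
  rewrite prodEFin -expR_sum lee_fin ler_expR.
  rewrite -(@sig_big_dep _ _ _ _ _ (fun=> true) (fun _ _ => true)
    (fun i (j : 'I_(m i)) => c i ^+ 2 / 8)) /=.
  rewrite /hmean_sizes.
  have S0 := lt0r_neq0 sum_inv_sizes_gt0.
  rewrite le_eqVlt; apply/orP; left; apply/eqP.
  transitivity (s ^+ 2 / 8 / n%:R ^+ 2 * \sum_(i < n) ((m i)%:R)^-1).
    rewrite mulr_sumr; apply: eq_bigr => i _.
    by rewrite sumr_const card_ord -mulr_natl /c; field; rewrite nR mR.
  by field; rewrite nR S0.
- by move=> p; exact: zD.1.
- move=> p; apply: measurableT_comp => //; apply: measurable_funM => //.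
  by apply: measurable_funB.
- by move=> p y; exact: expR_ge0.
- by move=> p; rewrite (le_lt_trans (gH p))// ltry.
Qed.
(** N is n^2 divided by the sum of the 1 / m_i, and this sum is at most n. *)
Lemma hmean_sizes_ge1 : 1 <= N.
Proof.
have S0 := sum_inv_sizes_gt0.
have Sn : \sum_(i < n) ((m i)%:R)^-1 <= n%:R :> R.
  rewrite -[leRHS]mulr1 mulr_natl -[n in leRHS]card_ord -sumr_const.
  by apply: ler_sum => i _; rewrite invf_le1 ?ltr0n// ler1n.
have n1 : 1 <= n%:R :> R by rewrite ler1n.
rewrite /hmean_sizes mulrAC ler_pdivlMr// mul1r (le_trans Sn)//.
by rewrite ler_peMr.
Qed.

(** Joint measurability in data and hypotheses allows the exchange of [Pr] and the joint prior by
    Tonelli's theorem. *)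
Lemma measurable_gap :
  measurable_fun [set: Omega * MF]
    (fun p => gap D loss (fun i j => @z i j p.1) (tnth p.2.2)).
Proof.
have mt i : measurable_fun [set: Omega * MF] (fun p => tnth p.2.2 i).
  apply: (measurableT_comp (measurable_tnth i)).
  exact: measurableT_comp measurable_snd measurable_snd.
rewrite /gap; apply: measurable_funM => //; apply: measurable_sum => i.
apply: measurable_funB.
  have mr := measurable_hypothesis_risk (loss01 i) (mloss i) (D i).
  exact: measurableT_comp mr (mt i).
apply: measurable_funM => //; apply: measurable_sum => j.
apply: (@measurableT_comp _ _ _ _ _ _ (fun q : F * Z => loss i q.1 q.2) setT
  (fun p : Omega * MF => (tnth p.2.2 i, z j p.1)) (mloss i)).
apply/measurable_fun_pairP; split; first exact: mt.
exact: (measurableT_comp (zD.1 i j) measurable_fst).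
Qed.

Lemma hypothesis_gap_itv i (S : 'I_(m i) -> Z) f :
  `|fine (\int[D i]_x (loss i f x)%:E)%E
    - (m i)%:R^-1 * \sum_(j < m i) loss i f (S j)| <= 1.
Proof.
have mf : measurable_fun setT (loss i f).
  exact: measurableT_comp (mloss i) (pair1_measurable f).
have [_ /andP[r0 r1]] := fine_integral_itv01 (D i) mf (loss01 i f).
have mR : 0 < (m i)%:R :> R by rewrite ltr0n.
have e0 : 0 <= (m i)%:R^-1 * \sum_(j < m i) loss i f (S j).
  rewrite mulr_ge0 ?invr_ge0// sumr_ge0// => j _.
  by have /andP[] := loss01 i f (S j).
have e1 : (m i)%:R^-1 * \sum_(j < m i) loss i f (S j) <= 1.
  rewrite ler_pdivrMl// mulr1 -[m i in leRHS]card_ord -sumr_const ler_sum// => j _.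
  by have /andP[] := loss01 i f (S j).
rewrite ler_norml; lra.
Qed.

Lemma gap_itv (S : forall i, 'I_(m i) -> Z) h : `|gap D loss S h| <= 1.
Proof.
have nR : 0 < n%:R :> R by rewrite ltr0n.
rewrite /gap normrM ger0_norm ?invr_ge0// ler_pdivrMl// mulr1.
rewrite (le_trans (ler_norm_sum _ _ _))// -[n in leRHS]card_ord -sumr_const.
by apply: ler_sum => i _; exact: hypothesis_gap_itv.
Qed.

(** The gap is a sum of functions of single hypotheses, so linearity reduces its joint mean to
    integrals against the marginals [Q i]. *)
Lemma integral_gap (S : forall i, 'I_(m i) -> Z)
    (hQ : probability (pprobability F R) R) (Q : 'I_n -> probability F R)
    (QQ : probability MF R) :
  is_joint_posterior hQ Q QQ ->
  (\int[QQ]_x (gap D loss S (tnth x.2))%:E =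
    (n%:R^-1 * \sum_(i < n) true_risk (D i) (loss i) (Q i)
     - n%:R^-1 * \sum_(i < n) emp_risk (loss i) (Q i) (S i))%:E)%E.
Proof.
move=> QQE.
pose r i f := fine (\int[D i]_x (loss i f x)%:E)%E.
pose e i f : R := (m i)%:R^-1 * \sum_(j < m i) loss i f (S i j).
have mr i : measurable_fun setT (r i) by exact: measurable_hypothesis_risk.
have me i : measurable_fun setT (e i).
  apply: measurable_funM => //; apply: measurable_sum => j.
  exact: measurableT_comp (mloss i) (pair2_measurable (S i j)).
have r01 i f : 0 <= r i f <= 1.
  by have [] := fine_integral_itv01 (D i)
    (measurableT_comp (mloss i) (pair1_measurable f)) (loss01 i f).
have ia i : QQ.-integrable setT (fun x => (r i (tnth x.2 i) - e i (tnth x.2 i))%:E).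
  apply: (@integrable_bounded _ _ _ _ _ 1) => [|x]; last exact: hypothesis_gap_itv.
  have mt : measurable_fun [set: MF] (fun x => tnth x.2 i).
    exact: measurableT_comp (measurable_tnth i) measurable_snd.
  by apply: measurable_funB; [exact: measurableT_comp (mr i) mt|
    exact: measurableT_comp (me i) mt].
rewrite /gap; under eq_integral do rewrite EFinM -sumEFin.
have -> : (\int[QQ]_x (n%:R^-1%:E *
      \sum_(i < n) (r i (tnth x.2 i) - e i (tnth x.2 i))%:E) =
    n%:R^-1%:E * \sum_(i < n) \int[QQ]_x (r i (tnth x.2 i) - e i (tnth x.2 i))%:E)%E.
  rewrite integralZl//; last exact: integrable_sum.
  by rewrite integral_sum.
rewrite -mulrBr EFinM -sumrB -sumEFin; congr (_ * _)%E.
apply: eq_bigr => i _.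
rewrite (integral_joint_posterior_tnth (phi := fun f => r i f - e i f) (M := 1) i QQE).
- rewrite EFinB -integral_hypothesis_risk// -integral_hypothesis_emp_risk//.
  have ir : (Q i).-integrable setT (fun f => (r i f)%:E).
    exact: integrable_itv01 (mr i) (r01 i).
  have ie : (Q i).-integrable setT (fun f => (e i f)%:E).
    (* The bound 2 combines 0 <= r <= 1 with |r - e| <= 1. *)
    apply: (@integrable_bounded _ _ _ _ _ 2) => // f.
    have := hypothesis_gap_itv (S i) f; rewrite -/(r i f) -/(e i f).
    by have /andP[] := r01 i f; rewrite !ler_norml; lra.
  by rewrite -integralB_EFin//; apply: eq_integral => f _; rewrite EFinB.
- exact: measurable_funB.
- by move=> f; exact: hypothesis_gap_itv.
Qed.

(** * The high-probability event and the bound that holds on it *)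

Definition exp_gap_mean (P : probability MF R) (k : nat) (w : Omega) : \bar R :=
  (\int[P]_x (expR (4 * N * grid_pt N k * gap D loss (fun i j => @z i j w) (tnth x.2)
    - 2 * N * grid_pt N k ^+ 2))%:E)%E.

(** A single use of Markov's inequality on the sum [H] of the moments over the grid covers all grid
    points at once. *)
Lemma pac_bayes_event (P : probability MF R) (delta : R) : 0 < delta ->
  exists E : set Omega, [/\ measurable E, (1 - delta%:E <= Pr E)%E &
    forall w, E w -> forall k : 'I_(grid_size N).+1,
      (exp_gap_mean P k w <= (4 * N / delta)%:E)%E].
Proof.
move=> delta0; have N1 := hmean_sizes_ge1.
pose g k (p : Omega * MF) : \bar R :=
  (expR (4 * N * grid_pt N k * gap D loss (fun i j => @z i j p.1) (tnth p.2.2)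
    - 2 * N * grid_pt N k ^+ 2))%:E.
have mg k : measurable_fun setT (g k).
  apply/measurable_EFinP; apply: measurableT_comp => //.
  apply: measurable_funB => //; apply: measurable_funM => //.
  exact: measurable_gap.
have g0 k p : (0 <= g k p)%E by rewrite lee_fin expR_ge0.
have mG k : measurable_fun setT (exp_gap_mean P k).
  exact: (measurable_fun_fubini_tonelli_F (m2 := P) (g k)).
have G0 k w : (0 <= exp_gap_mean P k w)%E.
  by apply: integral_ge0 => x _; rewrite lee_fin expR_ge0.
(* After the exchange of integrals [gap_mgf] applies at s = 4Nx; the subtracted 2Nx^2 is exactly s^2
   / (8N). *)
have EG k : (\int[Pr]_w exp_gap_mean P k w <= 1)%E.
  rewrite (fubini_tonelli (m1 := Pr) (m2 := P) (g k))//.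
  rewrite -[leRHS](@probability_setT _ _ _ P) -[leRHS]mul1e -integral_cst//.
  apply: ge0_le_integral => //.
  - by move=> x _; exact: integral_ge0.
  - exact: (measurable_fun_fubini_tonelli_G (m1 := Pr) (g k)).
  move=> x _ /=; set s : R := 4 * N * grid_pt N k.
  have s0 : 0 <= s.
    by rewrite mulr_ge0 ?divr_ge0//; lra.
  have mgx : measurable_fun setT
      (fun w => expR (s * gap D loss (fun i j => @z i j w) (tnth x.2))).
    apply: measurableT_comp => //; apply: measurable_funM => //.
    exact: (measurableT_comp measurable_gap (pair2_measurable x)).
  under eq_integral do rewrite /g/= expRD EFinM.
  rewrite ge0_integralZr//; last exact/measurable_EFinP.
  apply: (@le_trans _ _ ((expR (s ^+ 2 / (8 * N)))%:E
      * (expR (- (2 * N * grid_pt N k ^+ 2)))%:E)%E).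
    by rewrite lee_wpmul2r ?lee_fin ?expR_ge0// gap_mgf.
  rewrite -EFinM -expRD lee_fin -[leRHS](@expR0 R) ler_expR le_eqVlt; apply/orP; left.
  have N0 : N != 0 by rewrite gt_eqF//; lra.
  by apply/eqP; rewrite /s; field; move: N0; rewrite mulf_eq0 negb_or => /andP[-> ->].
pose H w := (\sum_(k < (grid_size N).+1) exp_gap_mean P k w)%E.
have mH : measurable_fun setT H by apply: emeasurable_sum.
have H0 w : (0 <= H w)%E by apply: sume_ge0.
have EH : (\int[Pr]_w H w <= (4 * N)%:E)%E.
  rewrite ge0_integral_sum//.
  apply: (@le_trans _ _ (\sum_(k < (grid_size N).+1) 1)%E); first exact: lee_sum.
  by rewrite sumEFin sumr_const card_ord lee_fin grid_size_le.
have C0 : 0 < 4 * N / delta by rewrite divr_gt0//; lra.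
pose B := [set w | ((4 * N / delta)%:E <= H w)%E].
have mB : measurable B.
  rewrite -[B]setTI; exact: measurable_lee.
(* Markov's inequality: [H] has mean at most 4N and is at least 4N / delta on [B]. *)
have PB : (Pr B <= delta%:E)%E.
  have -> : delta%:E = ((4 * N / delta)^-1%:E * (4 * N)%:E)%E.
    by rewrite -EFinM; congr EFin; rewrite invf_div divfK// gt_eqF//; lra.
  rewrite lee_pdivlMl//; apply: le_trans EH.
  rewrite -integral_cst//.
  apply: (@le_trans _ _ (\int[Pr]_(w in B) H w)%E).
    apply: ge0_le_integral => //.
    - by move=> x _; rewrite lee_fin ltW.
    - exact: measurable_funTS.
  exact: ge0_subset_integral.
exists (~` B); split.
- exact: measurableC.
- by rewrite probability_setC// leeB.
(* The moments are nonnegative, so each is at most their sum. *)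
move=> w /negP; rewrite -ltNge => wB k; apply: le_trans (ltW wB).
by rewrite /H (bigD1 k)//= leeDl// sume_ge0.
Qed.

(** Deterministic once [w] satisfies the moment bounds, hence simultaneous in all posteriors:
    Donsker-Varadhan with C = 4N / delta at each grid point, then [grid_sqrt]. *)
Lemma pac_bayes_bound (hQ : probability (pprobability F R) R)
    (Q : 'I_n -> probability F R) (QQ P : probability MF R) (w : Omega) (delta : R) :
  0 < delta -> is_joint_posterior hQ Q QQ -> (KL QQ P < +oo)%E ->
  (forall k : 'I_(grid_size N).+1, (exp_gap_mean P k w <= (4 * N / delta)%:E)%E) ->
  n%:R^-1 * \sum_(i < n) true_risk (D i) (loss i) (Q i)
      <= n%:R^-1 * \sum_(i < n) emp_risk (loss i) (Q i) (fun j => @z i j w)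
         + Num.sqrt ((fine (KL QQ P) + ln (4 * N / delta) + 1) / (2 * N)).
Proof.
move=> delta0 QQE KLoo GP; have N1 := hmean_sizes_ge1.
have C0 : 0 < 4 * N / delta by rewrite divr_gt0//; lra.
rewrite -lerBlDl.
have := integral_gap (fun i j => @z i j w) QQE.
set gw := gap D loss _; set a := _ - _ => ga.
have mgw : measurable_fun setT (fun x : MF => gw (tnth x.2)).
  exact: (measurableT_comp measurable_gap (pair1_measurable w)).
have gw1 (x : MF) : `|gw (tnth x.2)| <= 1 by exact: gap_itv.
have igw : QQ.-integrable setT (fun x => (gw (tnth x.2))%:E).
  exact: (@integrable_bounded _ _ _ _ _ 1).
have a1 : a <= 1.
  rewrite -lee_fin -ga -[leRHS](@probability_setT _ _ _ QQ) -[leRHS]mul1e -integral_cst//.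
  apply: le_integral => //; first exact: finite_measure_integrable_cst.
  by move=> x _; rewrite lee_fin (le_trans _ (gw1 x))// ler_norm.
apply: grid_sqrt => // k.
set x := grid_pt N k.
have ig : QQ.-integrable setT
    (EFin \o (fun t : MF => 4 * N * x * gw (tnth t.2) - 2 * N * x ^+ 2)).
  apply: (@integrable_bounded _ _ _ _ _ (`|4 * N * x| + `|2 * N * x ^+ 2|)).
    by apply: measurable_funB => //; exact: measurable_funM.
  move=> t; rewrite (le_trans (ler_normB _ _))// lerD2r normrM ler_piMr//.
have [Kfin] := donsker_varadhan C0 ig (GP k) KLoo.
have -> : (\int[QQ]_t (4 * N * x * gw (tnth t.2) - 2 * N * x ^+ 2)%:E =
    (4 * N * x)%:E * a%:E - (2 * N * x ^+ 2)%:E * QQ setT)%E.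
  under eq_integral do rewrite EFinB EFinM.
  rewrite integralB//; last 2 first.
  - exact: integrableZl.
  - exact: finite_measure_integrable_cst.
  by rewrite integralZl// ga integral_cst.
have QT (c : \bar R) : (c * QQ setT = c)%E by rewrite probability_setT mule1.
by rewrite QT -(fineK Kfin) -EFinM -EFinB -EFinD lee_fin.
Qed.

End pac_bayes.

(** * The bound with the event fixed before the joint prior *)

Unset Implicit Arguments.
Set Strict Implicit.

Theorem theorem3 (R : realType) (dO dZ dF : measure_display)
  (Omega : measurableType dO) (Z : measurableType dZ) (F : measurableType dF)
  (Pr : probability Omega R) (n : nat) (m : 'I_n -> nat)
  (D : 'I_n -> probability Z R) (loss : 'I_n -> F -> Z -> R)
  (z : forall i : 'I_n, 'I_(m i) -> Omega -> Z)
  (hyperP : probability (pprobability F R) R) (delta : R) :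
  (0 < n)%N ->
  (forall i, 0 < m i)%N ->
  (forall i f x, 0 <= loss i f x <= 1) ->
  (forall i, measurable_fun [set: F * Z] (fun p => loss i p.1 p.2)) ->
  indep_samples Pr D z ->
  0 < delta ->
  exists E : set Omega, measurable E /\ (1 - delta%:E <= Pr E)%E /\
    forall omega, E omega ->
    forall (hyperQ : probability (pprobability F R) R)
           (Q : 'I_n -> probability F R)
           (frakQ frakP : probability (pprobability F R * n.-tuple F)%type R),
      is_joint_posterior hyperQ Q frakQ ->
      is_joint_prior hyperP frakP ->
      (KL frakQ frakP < +oo)%E ->
      let mh := hmean_sizes m in
      n%:R^-1 * \sum_(i < n) true_risk (D i) (loss i) (Q i)
      <= n%:R^-1 * \sum_(i < n) emp_risk (loss i) (Q i) (fun j => z i j omega)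
         + Num.sqrt ((fine (KL frakQ frakP) + ln (4 * mh * n%:R / delta) + 1)
                     / (2 * mh * n%:R)).
Proof.
move=> n0 m0 loss01 mloss zD delta0.
(* A reference joint prior [P0] is chosen to build the event; if none exists, the claim is vacuous
   on the whole space. *)
have [[P0 hP0]|noP] := pselect (exists P0 : probability
    (pprobability F R * n.-tuple F)%type R, is_joint_prior hyperP P0); last first.
  exists setT; split => //; split.
    by rewrite probability_setT leeBlDr// leeDl// lee_fin ltW.
  by move=> omega _ hQ Q QQ P _ hP; exfalso; apply: noP; exists P.
have [E [mE PE EP0]] := pac_bayes_event n0 m0 loss01 mloss zD P0 delta0.
exists E; split => //; split => // omega Eomega hQ Q QQ P hQQ hP KLoo; cbv zeta.
rewrite -!(mulrA _ (hmean_sizes m)).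
apply: (pac_bayes_bound n0 m0 loss01 mloss zD delta0 hQQ KLoo) => k.
(* The given joint prior equals [P0] on measurable sets, so the moment bounds carry over. *)
rewrite /exp_gap_mean (@eq_measure_integral _ _ _ setT P0) => [|A mA _]; first exact: EP0.
exact: joint_prior_unique hP hP0 _ mA.
Qed.
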